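(* Let $n=p_1^{\alpha_1}p_2^{\alpha_2}\cdots p_k^{\alpha_k}$ be a positive odd integer which is not square free, where $p_1<p_2<\cdots<p_k$ are primes and $\alpha_i\ge 1$. Let $s$ be the smallest index in $\{1,\ldots,k\}$ with $\alpha_s>1$. Suppose $G$ is a non-cyclic nilpotent group of order $n$. Then $\phi(G)\le \phi(C_{n/p_s}\times C_{p_s})$. Therefore $$|\overleftrightarrow{E}(C_{n/p_s}\times C_{p_s})|\ge |\overleftrightarrow{E}(G)|,$$ i.e., the directed power graph of $C_{n/p_s}\times C_{p_s}$ has the maximum number of undirected edges among all non-cyclic nilpotent groups of order $n$.
   Context: $C_m$ denotes the cyclic group of order $m$, $o(g)$ the order of an element $g$, and $\phi$ Euler's totient function. For a finite group $G$, $\phi(G)=\sum_{g\in G}\phi(o(g))$. The directed power graph of $G$ has vertex set $G$ and an arc from $x$ to $y$ ($x\ne y$) iff $y=x^m$ for some positive integer $m$. Its set of undirected edges is $\overleftrightarrow{E}(G)=\{\{g,h\}: g,h\in G,\ h\in\langle g\rangle\setminus\{g\},\ g\in\langle h\rangle\setminus\{h\}\}$, i.e., pairs of distinct elements generating the same cyclic subgroup; thus $|\overleftrightarrow{E}(G)|=\frac12\sum_{g\in G}(\phi(o(g))-1)$. *)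

(* Defs.v *)
From mathcomp Require Import all_boot all_fingroup zmodp all_solvable.

Set Implicit Arguments.
Unset Strict Implicit.
Unset Printing Implicit Defensive.

Local Open Scope group_scope.

Definition square_free (n : nat) : Prop :=
  forall d : nat, (d ^ 2 %| n)%N -> d = 1%N.

Definition group_phi (gT : finGroupType) (G : {group gT}) : nat :=
  (\sum_(g in G) totient #[g])%N.

Definition power_arc (gT : finGroupType) (x y : gT) : Prop :=
  x <> y /\ exists2 m : nat, (0 < m)%N & y = x ^+ m.

(* An edge is the unordered pair [set g; h], so each edge is counted once;
   undirected_edgesP below relates this set to the arcs. *)
Definition undirected_edges (gT : finGroupType) (G : {group gT}) :
    {set {set gT}} :=
  [set [set g; h] | g in G, h in G
                  & (h \in <[g]> :\ g) && (g \in <[h]> :\ h)].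

(* Zp m is the additive group of the integers mod m, viewed as a multiplicative
   finite group; unlike the full group on the type 'Z_m, it is trivial (not of
   order 2) when m = 1. *)
Definition cyclic_prod (m q : nat) : {group 'Z_m * 'Z_q} :=
  [group of setX (Zp m) (Zp q)].

Lemma power_arcP (gT : finGroupType) (x y : gT) :
  power_arc x y <-> y \in <[x]> :\ x.
Proof.
rewrite in_setD1; split=> [[xDy [m _ def_y]] | /andP[yDx /cycleP[m def_y]]].
  by rewrite {2}def_y mem_cycle andbT eq_sym; apply/eqP.
split; first by apply/eqP; rewrite eq_sym.
exists (m + #[x])%N; first by rewrite addn_gt0 order_gt0 orbT.
by rewrite expgD expg_order mulg1.
Qed.

Lemma undirected_edgesP (gT : finGroupType) (G : {group gT}) (e : {set gT}) :
  e \in undirected_edges G <->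
  exists g h, [/\ g \in G, h \in G, power_arc g h, power_arc h g
                & e = [set g; h]].
Proof.
split=> [/imset2P[g h Gg] | [g [h [Gg Gh /power_arcP gh /power_arcP hg ->]]]].
  rewrite inE => /andP[Gh /andP[gh hg]] ->.
  by exists g, h; split=> //; apply/power_arcP.
by apply/imset2P; exists g h; rewrite // inE Gh gh hg.
Qed.

(* Main.v *)
(* Since phi is multiplicative over the Sylow subgroups of a nilpotent group, everything
   reduces to p-groups.  For a p-group P, phi(P) is a decreasing function of the numbers
   c_j(P) of solutions of x^(p^j) = 1 (for fixed order).  By Frobenius c_j(P) >= p^j, so
   the cyclic group maximizes phi.  If P is non-cyclic of odd order p^a, it has a normal
   subgroup E of order p^2 and exponent p; every L with E <= L <= P and |L| = p^(j+1) has
   exponent dividing p^j, so that c_j(P) >= p^(j+1) for 1 <= j < a, with equality for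
   C_(p^(a-1)) x C_p.  Finally, for a >= 2, the quotient
   r_p = phi(C_(p^(a-1)) x C_p) / phi(C_(p^a)) satisfies 1/p <= r_p <= 1/(p-1), so it is
   best to have the non-cyclic Sylow subgroup at the smallest possible prime. The number
   of edges follows from 2 |E(G)| + |G| = phi(G). *)
Require Import Defs.
From mathcomp Require Import all_boot all_fingroup zmodp all_solvable.
From mathcomp Require Import zify.

Set Implicit Arguments.
Unset Strict Implicit.
Unset Printing Implicit Defensive.

Local Open Scope group_scope.

(** * Sums of [totient] expressed through solution counts *)

(* The sum of [totient #[x]] over a p-group of exponent dividing [p ^ a] in which
   [c j] elements satisfy [x ^+ (p ^ j) = 1]. *)
Definition phi_of_counts (p : nat) (c : nat -> nat) (a : nat) : nat :=
  (c 0 + \sum_(j < a) (c j.+1 - c j) * totient (p ^ j.+1))%N.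

Definition cyclic_counts (p j : nat) : nat := (p ^ j)%N.

(* The counts of [C_(p ^ a) x C_p], valid for [j <= a]. *)
Definition rank2_counts (p j : nat) : nat := if j is 0 then 1%N else (p ^ j.+1)%N.

Lemma phi_of_countsS p c a :
  phi_of_counts p c a.+1 =
  (phi_of_counts p c a + (c a.+1 - c a) * totient (p ^ a.+1))%N.
Proof. by rewrite /phi_of_counts big_ord_recr /= addnA. Qed.

Lemma leq_totient_pfactor p j : prime p -> totient (p ^ j) <= totient (p ^ j.+1).
Proof.
move=> p_pr; case: j => [|j]; first by rewrite totient_gt0 expn_gt0 prime_gt0.
by rewrite !totient_pfactor // leq_mul // leq_pexp2l ?prime_gt0.
Qed.

(* Abel summation: the weight of [c j], for [j < a], is
   [totient (p ^ j) - totient (p ^ j.+1) <= 0]. *)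
Lemma leq_phi_of_counts p c d a : prime p ->
    (forall j, c j <= c j.+1) -> (forall j, d j <= d j.+1) ->
    (forall j, j <= a -> d j <= c j) -> c a = d a ->
  phi_of_counts p c a <= phi_of_counts p d a.
Proof.
(* Adding the boundary terms [d a * totient (p ^ a)] on the left and [c a * totient (p ^ a)] on the
   right makes the inequality independent of [c a = d a], so that induction on [a] applies. *)
move=> p_pr cS dS dc eq_a; rewrite -(leq_add2r (c a * totient (p ^ a))).
rewrite {1}eq_a; elim: a dc {eq_a} => [|a IHa] dc.
  by rewrite /phi_of_counts !big_ord0 expn0 !addn0 !muln1 addnC.
have {}IHa := IHa (fun j le_ja => dc j (leqW le_ja)).
rewrite !phi_of_countsS.
move: (cS a) (dS a) (dc a (leqnSn _)) (leq_totient_pfactor a p_pr) IHa.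
move: (phi_of_counts _ _ _) (phi_of_counts _ _ _) (totient _) (totient _).
move: (c a) (c a.+1) (d a) (d a.+1) => c0 c1 d0 d1 x y f1 f0 cS' dS' dc0 f01 IH.
rewrite !mulnBl; have := leq_mul dc0 (leqnn (f1 - f0)); rewrite !mulnBr.
(* These four inequalities ensure that no subtraction is truncated; the goal is then linear in the
   products. *)
have := leq_mul cS' (leqnn f1); have := leq_mul dS' (leqnn f1).
have := leq_mul (leqnn c0) f01; have := leq_mul (leqnn d0) f01.
lia.
Qed.

(** * Rank 2 against cyclic: the ratio at a single prime *)

Section Counts.

Variables (p : nat) (p_pr : prime p).

Let C := phi_of_counts p (cyclic_counts p).
Let A := phi_of_counts p (rank2_counts p).

(** Both values belong to order [p ^ b.+2]. Raising [b] by one adds to [C] exactly [p] times what it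
    adds to [A], so both bounds propagate from order [p ^ 2]. *)
Lemma phi_rank2_cyclic b :
  (p.-1 * A b.+1 <= C b.+2)%N /\ (C b.+2 <= p * A b.+1)%N.
Proof.
elim: b => [|b [IH1 IH2]].
  rewrite /A /C !phi_of_countsS /phi_of_counts !big_ord0 /=.
  rewrite /cyclic_counts !totient_pfactor //= !expn0 !expn1.
  have [m ->] : exists m, p = m.+2 by exists p.-2; have := prime_gt1 p_pr; lia.
  rewrite !expnS expn0 !muln1 /=.
  have -> : (m.+2 * m.+2 - 1 = m.+1 * m.+3)%N by lia.
  have -> : (m.+2 * m.+2 - m.+2 = m.+1 * m.+2)%N by lia.
  rewrite subn1 /=; lia.
have -> : A b.+2 = (A b.+1 + (p ^ b.+3 - p ^ b.+2) * (p.-1 * p ^ b.+1))%N.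
  by rewrite /A phi_of_countsS totient_pfactor.
have -> : C b.+3 = (C b.+2 + (p ^ b.+3 - p ^ b.+2) * (p.-1 * p ^ b.+2))%N.
  by rewrite /C phi_of_countsS totient_pfactor.
rewrite (mulnDr p.-1 (A _)) (mulnDr p (A _)).
set D := (p ^ b.+3 - _)%N; rewrite [(p ^ b.+2)%N]expnS.
have -> : (D * (p.-1 * (p * p ^ b.+1)) = p * (D * (p.-1 * p ^ b.+1)))%N by lia.
by split; apply: leq_add => //; apply: leq_mul => //; apply: leq_pred.
Qed.

End Counts.

(** With [r] the ratio of the rank 2 value to the cyclic one, this is
    [r_q <= 1/(q-1) <= 1/p <= r_p]. *)
Lemma phi_rank2_cyclic_exchange p q a b : prime p -> prime q -> (p < q)%N ->
  (phi_of_counts q (rank2_counts q) b.+1 * phi_of_counts p (cyclic_counts p) a.+2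
   <= phi_of_counts q (cyclic_counts q) b.+2
      * phi_of_counts p (rank2_counts p) a.+1)%N.
Proof.
move=> p_pr q_pr lt_pq.
have [_ le_p] := phi_rank2_cyclic p_pr a; have [le_q _] := phi_rank2_cyclic q_pr b.
apply: leq_trans (leq_mul (leqnn _) le_p) _.
rewrite mulnA leq_mul // mulnC (leq_trans _ le_q) // leq_mul //.
by rewrite -ltnS prednK // prime_gt0.
Qed.

(** * Bounds for a single [p]-group *)

Section PGroup.

Variables (gT : finGroupType) (p : nat) (p_pr : prime p).
Implicit Types P E X : {group gT}.

Definition Ldiv_counts (P : {group gT}) (j : nat) : nat := #|'Ldiv_(p ^ j)(P)|.

Lemma Ldiv_pfactorS P j : 'Ldiv_(p ^ j)(P) \subset 'Ldiv_(p ^ j.+1)(P).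
Proof.
apply/subsetP=> x /LdivP[Px xpj].
by apply/LdivP; split; rewrite // expnSr expgM xpj expg1n.
Qed.

Lemma Ldiv_countsS P j : Ldiv_counts P j <= Ldiv_counts P j.+1.
Proof. exact/subset_leq_card/Ldiv_pfactorS. Qed.

Lemma Ldiv1 P : 'Ldiv_1(P) = [set 1].
Proof.
by apply/setP=> x; rewrite in_set1; apply/LdivP/eqP => [[_] | ->].
Qed.

Lemma Ldiv_counts0 P : Ldiv_counts P 0 = 1%N.
Proof. by rewrite /Ldiv_counts expn0 Ldiv1 cards1. Qed.

Lemma Ldiv_counts_exponent P j : exponent P %| p ^ j -> Ldiv_counts P j = #|P|.
Proof.
move=> expP; congr #|pred_of_set _|; apply/eqP.
by rewrite eqEsubset subsetIl sub_Ldiv.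
Qed.

(** An element of ['Ldiv_(p ^ j.+1)(P)] outside ['Ldiv_(p ^ j)(P)] has order exactly [p ^ j.+1].
    Writing [P] as ['Ldiv_(p ^ a)(P)] frees [a] for the induction. *)
Lemma group_phi_Ldiv P a : exponent P %| p ^ a ->
  group_phi P = phi_of_counts p (Ldiv_counts P) a.
Proof.
move=> expP; rewrite /group_phi.
have -> : P :=: 'Ldiv_(p ^ a)(P).
  by apply/eqP; rewrite eqEsubset subsetIl sub_Ldiv expP.
elim: a {expP} => [|a IHa].
  rewrite /phi_of_counts big_ord0 addn0 Ldiv_counts0.
  by rewrite expn0 Ldiv1 big_set1 order1.
rewrite phi_of_countsS -IHa (big_setID 'Ldiv_(p ^ a)(P)) /=.
rewrite (setIidPr (Ldiv_pfactorS P a)) /Ldiv_counts -cardsDS ?Ldiv_pfactorS // -sum_nat_const.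
congr addn; apply: eq_bigr => x; rewrite inE => /andP[notL /LdivP[Px]].
move/eqP; rewrite -order_dvdn => /dvdn_pfactor-/(_ p_pr)[i].
rewrite leq_eqVlt => /predU1P[-> -> // | lt_ia ox].
case/LdivP: notL; split=> //; apply/eqP; rewrite -order_dvdn ox.
by rewrite dvdn_exp2l.
Qed.

Lemma group_phi_le_cyclic P a : #|P| = (p ^ a)%N ->
  group_phi P <= phi_of_counts p (cyclic_counts p) a.
Proof.
move=> oP; have expP : exponent P %| p ^ a by rewrite -oP exponent_dvdn.
rewrite (group_phi_Ldiv expP) leq_phi_of_counts // => [|j|j le_ja|].
- exact: Ldiv_countsS.
- by rewrite leq_pexp2l ?prime_gt0.
- rewrite dvdn_leq ?cardG_gt0 ?Frobenius_Ldiv ?oP ?dvdn_exp2l //.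
  by apply/card_gt0P; exists 1; apply/LdivP; rewrite expg1n.
by rewrite Ldiv_counts_exponent.
Qed.

(** The solutions form a cyclic subgroup, whose order is that of a generator killed by [m]. *)
Lemma card_Ldiv_cyclic X m : cyclic X -> (0 < m)%N -> #|'Ldiv_m(X)| <= m.
Proof.
move=> cycX m_gt0; have L_gr := group_Ldiv m (cyclic_abelian cycX).
have /cyclicP[y /= defL] : cyclic (group L_gr).
  by apply: cyclicS cycX; apply: subsetIl.
have /LdivP[_ ym] : y \in 'Ldiv_m(X) by rewrite defL cycle_id.
by rewrite defL dvdn_leq // order_dvdn ym.
Qed.

Lemma cyclic_group_phi_ge P a : cyclic P -> #|P| = (p ^ a)%N ->
  phi_of_counts p (cyclic_counts p) a <= group_phi P.
Proof.
move=> cycP oP; have expP : exponent P %| p ^ a by rewrite -oP exponent_dvdn.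
rewrite (group_phi_Ldiv expP) leq_phi_of_counts // => [j|j|j le_ja|].
- by rewrite leq_pexp2l ?prime_gt0.
- exact: Ldiv_countsS.
- by rewrite card_Ldiv_cyclic // expn_gt0 prime_gt0.
by rewrite Ldiv_counts_exponent.
Qed.

Lemma rank2_counts_homo j : (rank2_counts p j <= rank2_counts p j.+1)%N.
Proof. by case: j => [|j]; rewrite ?expn_gt0 ?leq_pexp2l ?prime_gt0. Qed.

(* The kernel of [x |-> x ^+ (p ^ j)] meets [X] in at most [p ^ j] elements, and its
   image in [P / X] has at most [p] elements. *)
Lemma abelian_group_phi_ge P X a : abelian P -> X \subset P -> cyclic X ->
    #|P| = (p ^ a.+1)%N -> #|X| = (p ^ a)%N -> (0 < a)%N -> exponent P %| p ^ a ->
  phi_of_counts p (rank2_counts p) a <= group_phi P.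
Proof.
move=> abP sXP cycX oP oX a_gt0 expP.
rewrite (group_phi_Ldiv expP) leq_phi_of_counts // => [j|j|[|j] _|].
- exact: rank2_counts_homo.
- exact: Ldiv_countsS.
- by rewrite Ldiv_counts0.
- pose L := group (group_Ldiv (p ^ j.+1) abP).
  have -> : rank2_counts p j.+1 = (p ^ j.+1 * p)%N by rewrite -expnSr.
  rewrite -[Ldiv_counts P _]/#|L| -(LagrangeI L X) leq_mul //.
    apply: leq_trans (card_Ldiv_cyclic (m := p ^ j.+1) cycX _); last first.
      by rewrite expn_gt0 prime_gt0.
    apply/subset_leq_card/subsetP=> x; rewrite inE => /andP[/LdivP[_ xp] Xx].
    exact/LdivP.
  have sLP: L \subset P := subsetIl _ _.
  have <- : #|P : X| = p.
    by rewrite -divgS // oP oX expnS mulnK // expn_gt0 prime_gt0.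
  rewrite -!card_lcosets subset_leq_card //.
  apply/subsetP=> _ /lcosetsP[x Lx ->].
  by apply/lcosetsP; exists x; rewrite ?(subsetP sLP).
(* Here [0 < a] excludes the exceptional value of [rank2_counts p] at 0. *)
by rewrite Ldiv_counts_exponent // oP; case: a a_gt0 {oP oX expP}.
Qed.

(** If every normal abelian subgroup were cyclic, [P] would be cyclic or an extremal 2-group.
    Otherwise ['Ohm_1(X)], for a non-cyclic normal abelian [X], is elementary abelian of rank at
    least 2 and contains a suitable [E]. *)
Lemma odd_noncyclic_normal_p2 P : p.-group P -> odd #|P| -> ~~ cyclic P ->
  exists E : {group gT}, [/\ E <| P, #|E| = (p ^ 2)%N & exponent E %| p].
Proof.
move=> pP oddP ncP.
have [X [nsXP abX ncX]] : exists X : {group gT}, [/\ X <| P, abelian X & ~~ cyclic X].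
  have [/existsP[X /and3P[]]|] :=
    boolP [exists X : {group gT}, [&& X <| P, abelian X & ~~ cyclic X]].
    by exists X.
  rewrite negb_exists => /forallP noX.
  have [X nsXP abX|cycP|] := normal_rank1_structure pP.
  - by have:= noX X; rewrite nsXP abX negbK.
  - by rewrite cycP in ncP.
  by rewrite (negPf (odd_not_extremal2 oddP)) andbF.
have pX : p.-group X := pgroupS (normal_sub nsXP) pP.
have nsOP : 'Ohm_1(X) <| P := char_normal_trans (Ohm_char 1 X) nsXP.
have abO : p.-abelem 'Ohm_1(X) by rewrite Ohm1_abelem.
have [|E [sEO nsEP oE]] := normal_pgroup (r := 2) pP nsOP.
  rewrite -(rank_abelem abO) rank_Ohm1 ltnNge.
  by apply: contra ncX; rewrite -abelian_rank1_cyclic.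
exists E; split=> //; apply: dvdn_trans (exponentS sEO) _.
by case/and3P: abO.
Qed.

Lemma odd_noncyclic_Ldiv_counts P a j : #|P| = (p ^ a.+1)%N -> odd #|P| ->
  ~~ cyclic P -> (j <= a)%N -> (rank2_counts p j <= Ldiv_counts P j)%N.
Proof.
move=> oP oddP ncP; case: j => [|j] lt_ja; first by rewrite Ldiv_counts0.
have pP : p.-group P by rewrite /pgroup oP pnatX pnat_id.
have [E [nsEP oE expE]] := odd_noncyclic_normal_p2 pP oddP ncP.
have oPE : (#|P / E| * p ^ 2 = p ^ a.+1)%N.
  by rewrite card_quotient ?normal_norm // -oE mulnC Lagrange ?normal_sub.
have le_j : j <= logn p #|P / E|.
  have := congr1 (logn p) oPE.
  by rewrite lognM ?cardG_gt0 ?expn_gt0 ?prime_gt0 // !pfactorK //; lia.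
(* [L] is the preimage of a subgroup of order [p ^ j] of [P / E]; hence [x ^+ (p ^ j)] lies in [E]
   for each [x] in [L]. *)
have [Lb [sLb _ oLb]] := normal_pgroup (quotient_pgroup E pP) (normal_refl _) le_j.
have [L defLb sEL sLP] := inv_quotientS nsEP sLb.
have nEL : L \subset 'N(E) := subset_trans sLP (normal_norm nsEP).
have oL : #|L| = (p ^ j.+2)%N.
  by rewrite -(Lagrange sEL) -card_quotient // -defLb oLb oE -expnD.
rewrite /= -oL subset_leq_card //; apply/subsetP=> x Lx.
apply/LdivP; split; first exact: (subsetP sLP).
rewrite expnSr expgM; apply/eqP; rewrite -order_dvdn.
apply: dvdn_trans expE; apply: dvdn_exponent.
have Nx := subsetP nEL x Lx; rewrite coset_idr ?groupX // morphX //.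
by apply/eqP; rewrite -order_dvdn -oLb order_dvdG // defLb mem_quotient.
Qed.

Lemma odd_noncyclic_group_phi_le P a : #|P| = (p ^ a.+1)%N -> odd #|P| ->
  ~~ cyclic P -> (0 < a)%N /\ group_phi P <= phi_of_counts p (rank2_counts p) a.
Proof.
move=> oP oddP ncP; have a_gt0 : (0 < a)%N.
  rewrite lt0n; apply: contra ncP => /eqP a0.
  by rewrite prime_cyclic // oP a0 expn1.
have oA : rank2_counts p a = #|P| by rewrite oP; case: a a_gt0 {oP}.
have leP j := odd_noncyclic_Ldiv_counts (j := j) oP oddP ncP.
(* At [j = a] the lower bound on the counts is already [#|P|], so the sum may stop at [a] instead of
   [a.+1]. *)
have expP : exponent P %| p ^ a.
  have /eqP eqL : 'Ldiv_(p ^ a)(P) == P by rewrite eqEcard subsetIl -oA leP.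
  by rewrite -sub_Ldiv eqL.
split=> //; rewrite (group_phi_Ldiv expP) leq_phi_of_counts // => [j|j|].
- exact: Ldiv_countsS.
- exact: rank2_counts_homo.
by rewrite Ldiv_counts_exponent.
Qed.

End PGroup.

(** * Counting edges *)

(** Double counting of incidences: [g] lies on one edge for each other generator of [<[g]>], and
    each edge has two endpoints. *)
Lemma undirected_edges_phi (gT : finGroupType) (G : {group gT}) :
  (#|undirected_edges G| * 2 + #|G| = group_phi G)%N.
Proof.
pose N (g : gT) := [set h | (h \in <[g]> :\ g) && (g \in <[h]> :\ h)].
have totE g : totient #[g] = (#|N g| + 1)%N.
  rewrite totient_gen addn1 (cardsD1 g) inE /generator eqxx add1n; congr _.+1.
  apply: eq_card => h; rewrite !inE [g == h]eq_sym eqEsubset !cycle_subG.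
  by case: (h == g); rewrite //= andbC.
have N_G g h : g \in G -> h \in N g -> h \in G.
  move=> Gg; rewrite inE in_setD1 -andbA => /and3P[_ gh _].
  by move: h gh; apply/subsetP; rewrite cycle_subG.
have edge_g g : g \in G ->
  [set e in undirected_edges G | g \in e] = [set [set g; h] | h in N g].
  move=> Gg; apply/setP=> e; rewrite inE; apply/andP/imsetP => [[] | [h Nh ->]].
    case/imset2P=> a b Ga; rewrite inE => /andP[Gb Nab] -> /set2P[] ->.
      by exists b => //; rewrite inE.
    by exists a; [rewrite inE andbC | rewrite setUC].
  split; last by rewrite set21.
  apply/imset2P; exists g h => //; rewrite inE (N_G g) //.
  by rewrite inE in Nh.
have card_N g : g \in G -> #|N g| = #|[set e in undirected_edges G | g \in e]|.
  move=> Gg; rewrite edge_g // card_in_imset // => h k.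
  rewrite !inE => /andP[/andP[hg _] _] /andP[/andP[kg _] _] /setP/(_ h).
  by rewrite !inE eqxx orbT (negPf hg) => /esym/eqP.
rewrite /group_phi (eq_bigr _ (fun g _ => totE g)) big_split /= sum1_card.
congr addn; rewrite (eq_bigr _ card_N) -sum_nat_const.
transitivity (\sum_(e in undirected_edges G) \sum_(g in e) 1)%N.
  apply: eq_bigr => e /imset2P[g h Gg].
  rewrite !inE => /andP[_ /andP[/andP[hg _] _]] ->.
  by rewrite sum1_card cards2 eq_sym hg.
rewrite (exchange_big_dep (mem G)) /= => [|e g].
  by apply: eq_bigr => g Gg; rewrite -sum1_card; apply: eq_bigl => e; rewrite inE.
case/imset2P=> a b Ga; rewrite inE => /andP[Gb _] ->.
by case/set2P=> ->.
Qed.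

(** * Multiplicativity over Sylow subgroups *)

(** Each element is uniquely a product of commuting factors from [A] and [B], of coprime orders; the
    orders multiply, and so do their totients. *)
Lemma group_phi_coprime_dprod (gT : finGroupType) (A B G : {group gT}) :
  A \x B = G -> coprime #|A| #|B| -> group_phi G = (group_phi A * group_phi B)%N.
Proof.
move=> defG coAB; have /mulgmP/misomP[fM isoG] := defG.
have [_ _ cAB _] := dprodP defG.
have := isom_im isoG; rewrite morphimEdom /= => defM.
rewrite /group_phi -defM big_imset /=; last exact/injmP/(isom_inj isoG).
rewrite big_distrlr /= pair_big /=.
apply: eq_big => [[a b] | [a b]]; rewrite inE //= => /andP[Aa Bb].
have co_ab : coprime #[a] #[b].
  by rewrite (coprime_dvdl (order_dvdG Aa)) ?(coprime_dvdr (order_dvdG Bb)).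
have cab : commute a b by apply/esym/(centsP cAB).
by rewrite -totient_coprime // -orderM.
Qed.

Lemma group_phi_bigdprod (gT : finGroupType) (r : seq nat) (F : nat -> {group gT})
    (G : {group gT}) : uniq r -> (forall p : nat, p.-group (F p)) ->
    \big[dprod/1]_(p <- r) F p = G ->
  group_phi G = (\prod_(p <- r) group_phi (F p))%N.
Proof.
move=> r_uniq pF; elim: r r_uniq G => [_|p r IHr /= /andP[r'p r_uniq]] G.
  rewrite !big_nil => G1; rewrite /group_phi -G1 big_set1 order1 //.
rewrite !big_cons => defG; have [[_ L _ defL] _ _ _] := dprodP defG.
rewrite defL in defG; rewrite -(IHr r_uniq L defL).
apply: group_phi_coprime_dprod defG _; rewrite -(bigdprod_card defL).
rewrite big_seq; elim/big_ind: _ => [|m1 m2 co1 co2|q r_q]; first exact: coprimen1.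
  by rewrite coprimeMr co1.
apply: pnat_coprime (pF p) _; apply: sub_in_pnat (pF q) => s _.
by rewrite !inE => /eqP->; apply: contraNneq r'p => <-.
Qed.

Lemma group_phi_pcore (gT : finGroupType) (G : {group gT}) : nilpotent G ->
  group_phi G = (\prod_(p <- primes #|G|) group_phi 'O_p(G))%N.
Proof.
move=> nilG; apply: group_phi_bigdprod (primes_uniq _) _ _ => [p|].
  exact: pcore_pgroup.
(* The Fitting subgroup is defined as the direct product of the ['O_p(G)], and is all of [G] when
   [G] is nilpotent. *)
exact: nilpotent_Fitting.
Qed.

(** * Choosing the prime of the non-cyclic Sylow subgroup *)

Section PrimeParts.

Variable n : nat.

Definition cyclic_part (p : nat) := phi_of_counts p (cyclic_counts p) (logn p n).

(** The predecessor appears because [C_(p ^ a) x C_p] has order [p ^ a.+1]. *)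
Definition rank2_part (p : nat) := phi_of_counts p (rank2_counts p) (logn p n).-1.

(* [phi] of [C_(n %/ q) x C_q] when [q ^ 2] divides [n]. *)
Definition rank2_at (q : nat) : nat :=
  (rank2_part q * \prod_(p <- primes n | p != q) cyclic_part p)%N.

(** The factors at primes other than [q] and [t] agree on both sides; the exchange inequality
    settles the rest. *)
Lemma leq_rank2_at q t : q \in primes n -> t \in primes n ->
    (1 < logn q n)%N -> (1 < logn t n)%N -> (q <= t)%N ->
  (rank2_at t <= rank2_at q)%N.
Proof.
move=> n_q n_t q2 t2; rewrite leq_eqVlt => /predU1P[-> // | lt_qt].
have pr_n r : r \in primes n -> prime r by rewrite mem_primes => /andP[].
have [neq_qt neq_tq] : q != t /\ t != q by rewrite neq_ltn lt_qt neq_ltn lt_qt orbT.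
rewrite /rank2_at -[in X in (X <= _)%N]big_filter -[in X in (_ <= X)%N]big_filter.
rewrite (bigD1_seq q) ?filter_uniq ?primes_uniq ?mem_filter ?neq_qt //=.
rewrite [X in (_ <= _ * X)%N](bigD1_seq t) ?filter_uniq ?primes_uniq //=; last first.
  by rewrite mem_filter neq_tq.
rewrite !big_filter_cond !mulnA; apply: leq_mul; last first.
  by rewrite leq_eqVlt; apply/orP; left; apply/eqP; apply: eq_bigl => p; rewrite andbC.
rewrite [X in (_ <= X)%N]mulnC /rank2_part /cyclic_part.
by move: q2 t2; case: (logn q n) => [|[|a]] //; case: (logn t n) => [|[|b]] // _ _;
  apply: phi_rank2_cyclic_exchange; rewrite ?pr_n.
Qed.

(** A nilpotent group whose Sylow subgroups are all cyclic is cyclic, so some ['O_t(G)] is not; the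
    remaining factors are bounded by their cyclic values. *)
Lemma noncyclic_nilpotent_group_phi_le (gT : finGroupType) (G : {group gT}) :
    #|G| = n -> odd n -> nilpotent G -> ~~ cyclic G ->
  exists t, [/\ t \in primes n, (1 < logn t n)%N & (group_phi G <= rank2_at t)%N].
Proof.
move=> oG n_odd nilG ncG.
have hallG (p : nat) : p.-Hall(G) 'O_p(G) by apply: nilpotent_pcore_Hall.
have oO (p : nat) : #|'O_p(G)| = (p ^ logn p n)%N.
  by rewrite (card_Hall (hallG p)) oG p_part.
have [t n_t ncO] : exists2 t, t \in primes n & ~~ cyclic 'O_t(G).
  apply/(hasP (a := fun p : nat => ~~ cyclic 'O_p(G))).
  rewrite (has_predC (fun p : nat => cyclic 'O_p(G))).
  apply: contra ncG => /allP cycO.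
  apply: nil_Zgroup_cyclic (nilG); apply/forall_inP=> V /SylowP[p p_pr sylV].
  have [/cycO | n'p] := boolP (p \in primes n).
    by rewrite -(nilpotent_Hall_pcore nilG sylV).
  have logp0 : logn p n = 0%N by apply/eqP; rewrite -leqn0 leqNgt logn_gt0.
  have -> : V :=: 1; last exact: cyclic1.
  by apply: card1_trivg; rewrite (card_Hall sylV) oG p_part logp0.
have pr_n r : r \in primes n -> prime r by rewrite mem_primes => /andP[].
have t_gt0 : (0 < logn t n)%N by rewrite logn_gt0.
have oOt : #|'O_t(G)| = (t ^ (logn t n).-1.+1)%N by rewrite prednK.
have [|a_gt0 le_t] := odd_noncyclic_group_phi_le (pr_n t n_t) oOt _ ncO.
  apply: dvdn_odd n_odd; rewrite oO.
  exact: pfactor_dvdnn.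
exists t; split=> //; first by rewrite -[logn t n]prednK.
rewrite group_phi_pcore // oG (bigD1_seq t) ?primes_uniq //= leq_mul //.
rewrite big_seq_cond [X in (_ <= X)%N]big_seq_cond.
elim/big_ind2: _ => // [m1 m2 m3 m4 | p /andP[n_p _]]; first exact: leq_mul.
by rewrite /cyclic_part (group_phi_le_cyclic (pr_n p n_p) (oO p)).
Qed.

(** Since [X] has index [q], away from [q] the Sylow subgroups of [H] are those of [X], hence
    cyclic; at [q] a cyclic subgroup of index [q] remains. *)
Lemma abelian_group_phi_ge_rank2 (gT : finGroupType) (H X : {group gT}) (q : nat) :
    #|H| = n -> abelian H -> X \subset H -> cyclic X -> prime q ->
    #|H| = (#|X| * q)%N -> q %| #|X| -> exponent H %| #|X| ->
  (rank2_at q <= group_phi H)%N.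
Proof.
move=> oH abH sXH cycX q_pr oHX qX expH.
have nilH := abelian_nil abH; have nilX := abelian_nil (cyclic_abelian cycX).
have n_gt0 : (0 < n)%N by rewrite -oH.
have oO (p : nat) : #|'O_p(H)| = (p ^ logn p n)%N.
  by rewrite (card_Hall (nilpotent_pcore_Hall p nilH)) oH p_part.
have oOX (p : nat) : #|'O_p(X)| = (p ^ logn p #|X|)%N.
  by rewrite (card_Hall (nilpotent_pcore_Hall p nilX)) p_part.
have cycOX (p : nat) : cyclic 'O_p(X) by apply: cyclicS cycX; apply: pcore_sub.
have sOX (p : nat) : 'O_p(X) \subset 'O_p(H).
  apply: pcore_max (pcore_pgroup _ _) _.
  by rewrite -sub_abelian_normal // (subset_trans (pcore_sub _ _)).
have logn_n p : logn p n = (logn p #|X| + (p == q))%N.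
  by rewrite -oH oHX lognM ?cardG_gt0 ?prime_gt0 // (logn_prime _ q_pr).
have pr_n r : r \in primes n -> prime r by rewrite mem_primes => /andP[].
have n_q : q \in primes n by rewrite -logn_gt0 logn_n eqxx addn1.
rewrite group_phi_pcore // oH (bigD1_seq q) ?primes_uniq //= leq_mul //.
  rewrite /rank2_part logn_n eqxx addn1 /=.
  have abO : abelian 'O_q(H) by apply: abelianS abH; apply: pcore_sub.
  apply: (abelian_group_phi_ge q_pr abO (sOX q) (cycOX q)); rewrite ?oOX //.
  - by rewrite oO logn_n eqxx addn1.
  - by rewrite logn_gt0 mem_primes q_pr cardG_gt0.
  (* The exponent of ['O_q(H)] is a power of [q] dividing [#|X|], so it divides the [q]-part of
     [#|X|]. *)
  have qO : q.-nat (exponent 'O_q(H)).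
    by apply: pnat_dvd (exponent_dvdn _) _; apply: pcore_pgroup.
  rewrite -(part_pnat_id qO) -p_part partn_dvd //.
  exact: dvdn_trans (exponentS (pcore_sub _ _)) expH.
rewrite big_seq_cond [X in (_ <= X)%N]big_seq_cond.
elim/big_ind2: _ => // [m1 m2 m3 m4 | p /andP[n_p neq_pq]]; first exact: leq_mul.
have /eqP eqO : 'O_p(X) == 'O_p(H).
  by rewrite eqEcard sOX oO oOX logn_n (negPf neq_pq) addn0 /=.
have cycO : cyclic 'O_p(H) by rewrite -eqO.
by rewrite /cyclic_part (cyclic_group_phi_ge (pr_n p n_p) cycO (oO p)).
Qed.

End PrimeParts.

(** * The extremal group [C_m x C_q] *)

Section CyclicProd.

Lemma expg_pair (gT1 gT2 : finGroupType) (x : gT1 * gT2) k :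
  x ^+ k = (x.1 ^+ k, x.2 ^+ k).
Proof. by elim: k => // k IHk; rewrite !expgS IHk. Qed.

Lemma cyclic_Zp m : cyclic (Zp m).
Proof.
by rewrite /Zp; case: ifP => _; rewrite ?cyclic1 // Zp_cycle cycle_cyclic.
Qed.

Variables m q : nat.
Hypotheses (m_gt0 : (0 < m)%N) (q_gt0 : (0 < q)%N).

Lemma card_cyclic_prod : #|cyclic_prod m q| = (m * q)%N.
Proof. by rewrite cardsX !card_Zp. Qed.

Lemma abelian_cyclic_prod : abelian (cyclic_prod m q).
Proof.
apply/centsP=> -[a b] /setXP[Za Zb] [c d] /setXP[Zc Zd]; congr (_, _).
  exact: (centsP (cyclic_abelian (cyclic_Zp m))).
exact: (centsP (cyclic_abelian (cyclic_Zp q))).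
Qed.

Lemma exponent_cyclic_prod : q %| m -> exponent (cyclic_prod m q) %| m.
Proof.
move=> q_m; apply/exponentP=> -[a b] /setXP[/= Za Zb].
rewrite expg_pair /=; congr (_, _); apply/eqP; rewrite -order_dvdn.
  by rewrite -[X in _ %| X](card_Zp m_gt0) order_dvdG.
by apply: dvdn_trans q_m; rewrite -[X in _ %| X](card_Zp q_gt0) order_dvdG.
Qed.

(** A generator would have order [m * q], yet the exponent divides [m]. *)
Lemma noncyclic_cyclic_prod : q %| m -> (1 < q)%N -> ~~ cyclic (cyclic_prod m q).
Proof.
move=> q_m q_gt1; apply/negP=> /cyclicP[x defH].
have Hx : x \in cyclic_prod m q by rewrite defH cycle_id.
have := dvdn_trans (dvdn_exponent Hx) (exponent_cyclic_prod q_m).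
rewrite orderE -defH card_cyclic_prod => /(dvdn_leq m_gt0).
by rewrite leqNgt ltn_Pmulr.
Qed.

Lemma cyclic_factor_cyclic_prod : exists X : {group 'Z_m * 'Z_q},
  [/\ X \subset cyclic_prod m q, cyclic X & #|X| = m].
Proof.
exists (setX_group (Zp_group m) 1%G); split; first by rewrite setXS // sub1G.
  by rewrite /= -morphim_pairg1 morphim_cyclic ?cyclic_Zp.
by rewrite cardsX card_Zp // cards1 muln1.
Qed.

End CyclicProd.

(** * Reading exponents and primes off the factorisation of [n] *)

Section PrimeFactorisation.

Variables (k : nat) (p alpha : 'I_k -> nat).
Hypotheses (p_prime : forall i, prime (p i)) (p_inj : injective p).

Let n := (\prod_(i < k) p i ^ alpha i)%N.

Lemma logn_prod_prime_powers i : logn (p i) n = alpha i.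
Proof.
rewrite /n (bigD1 i) //=; set m := (\prod_(j < k | _) _)%N.
have /andP[m_gt0 /eqP m0] : (0 < m)%N && (logn (p i) m == 0%N).
  rewrite /m; elim/big_ind: _ => [|a b /andP[a0 /eqP la] /andP[b0 /eqP lb]|j ne_ji].
  - by rewrite logn1.
  - by rewrite muln_gt0 a0 b0 lognM // la lb.
  rewrite expn_gt0 prime_gt0 // lognX logn_prime // (inj_eq p_inj).
  by rewrite [i == j]eq_sym (negPf ne_ji) muln0.
have pa_gt0 : (0 < p i ^ alpha i)%N by rewrite expn_gt0 prime_gt0.
by rewrite (lognM _ pa_gt0 m_gt0) m0 addn0 pfactorK.
Qed.

Lemma prime_prod_prime_powers r : r \in primes n -> exists i, r = p i.
Proof.
rewrite mem_primes => /and3P[r_pr _].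
rewrite /n; elim/big_ind: _ => [|a b IHa IHb|i _].
- by rewrite dvdn1 => /eqP r1; rewrite r1 in r_pr.
- by rewrite Euclid_dvdM // => /orP[].
by rewrite Euclid_dvdX // dvdn_prime2 // => /andP[/eqP ri _]; exists i.
Qed.

End PrimeFactorisation.

Local Close Scope group_scope.

Theorem mainTheorem1 (k : nat) (p alpha : 'I_k -> nat) (n : nat) (s : 'I_k)
  (p_prime : forall i : 'I_k, prime (p i))
  (p_incr : forall i j : 'I_k, i < j -> p i < p j)
  (alpha_ge1 : forall i : 'I_k, 1 <= alpha i)
  (n_def : n = \prod_(i < k) p i ^ alpha i)
  (n_odd : odd n)
  (n_not_sqf : ~ square_free n)
  (s_gt1 : 1 < alpha s)
  (s_min : forall i : 'I_k, 1 < alpha i -> s <= i) :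
  let H := cyclic_prod (n %/ p s) (p s) in
  [/\ #|H| = n, nilpotent H & ~~ cyclic H] /\
  (forall (gT : finGroupType) (G : {group gT}),
     #|G| = n -> nilpotent G -> ~~ cyclic G ->
     group_phi G <= group_phi H /\
     #|undirected_edges G| <= #|undirected_edges H|).
Proof.
have p_inj : injective p.
  move=> i j eq_p; apply: val_inj; case: (ltngtP i j) => // /p_incr.
    by rewrite eq_p ltnn.
  by rewrite eq_p ltnn.
have logn_p i : logn (p i) n = alpha i.
  by rewrite n_def (logn_prod_prime_powers alpha p_prime p_inj).
have n_primes r : r \in primes n -> exists i, r = p i.
  by rewrite n_def => /(prime_prod_prime_powers p_prime).
have n_gt0 : 0 < n by case: n n_odd {n_def n_not_sqf logn_p n_primes}.
set q := p s; set m := n %/ q => H.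
have q_pr : prime q := p_prime s.
have q2_n : q ^ 2 %| n by rewrite pfactor_dvdn // logn_p.
have n_mq : (m * q)%N = n by rewrite divnK // (dvdn_trans _ q2_n) ?dvdn_exp.
have q_m : q %| m by rewrite -(dvdn_pmul2r (prime_gt0 q_pr)) n_mq mulnn.
have [m_gt0 q_gt0] : 0 < m /\ 0 < q by apply/andP; rewrite -muln_gt0 n_mq.
have oH : #|H| = n by rewrite card_cyclic_prod.
have abH : abelian H by apply: abelian_cyclic_prod.
split; first split=> //.
- exact: abelian_nil.
- exact: noncyclic_cyclic_prod (prime_gt1 q_pr).
move=> gT G oG nilG ncG.
(* As [G] and [H] have equal order, comparing edges amounts to comparing [group_phi]. *)
suff le_phi : group_phi G <= group_phi H.
  split=> //; move: le_phi; rewrite -!undirected_edges_phi oG oH.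
  by rewrite leq_add2r leq_pmul2r.
have [t [n_t t2 le_G]] := noncyclic_nilpotent_group_phi_le oG n_odd nilG ncG.
have [X [sXH cycX oX]] := cyclic_factor_cyclic_prod q m_gt0.
have le_H : rank2_at n q <= group_phi H.
  apply: (abelian_group_phi_ge_rank2 oH abH sXH cycX q_pr); rewrite ?oX ?oH //.
  exact: exponent_cyclic_prod.
apply: leq_trans le_G (leq_trans _ le_H).
have n_q : q \in primes n by rewrite -logn_gt0 logn_p ltnW.
apply: leq_rank2_at => //; first by rewrite logn_p.
(* Now [t = p i] with [1 < alpha i], so minimality of [s] gives [s <= i], and [q <= t] because [p]
   is increasing. *)
have [i t_i] := n_primes t n_t; rewrite t_i logn_p in t2.
have := s_min i t2; rewrite leq_eqVlt t_i => /predU1P[/val_inj <- //|].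
by move/p_incr/ltnW.
Qed.
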